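(* Let $\Delta, c$ be positive integers such that $(\Delta+1)/2 < c \leq \Delta$. Any (possibly randomized) one-pass streaming algorithm that outputs a proper $c$-coloring of a given $c$-colorable $n$-vertex graph of maximum degree $\Delta$ requires $\Omega(n(\Delta-c+1))$ bits of space.
   Context: Streaming model: the edges of the input graph arrive one at a time in an arbitrary order (each edge appearing once), and the algorithm makes a single pass, after which it must output a proper $c$-coloring (an assignment of colors from $\{1,\dots,c\}$ to vertices such that adjacent vertices get different colors). A randomized algorithm is required to output a correct coloring with probability at least $2/3$ on every input. *)

(* Defs.v *)
From HB Require Import structures.
From mathcomp Require Import all_boot all_order all_algebra.
From mathcomp Require Import all_classical all_reals all_analysis.

Set Implicit Arguments.
Unset Strict Implicit.
Unset Printing Implicit Defensive.

Import Order.TTheory GRing.Theory Num.Theory.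

Local Open Scope ring_scope.

(* Edges are unordered pairs, i.e. two-element subsets of 'I_n, and a graph on
   'I_n is its edge set. *)
Definition simple_graph (n : nat) (E : {set {set 'I_n}}) : bool :=
  [forall e in E, #|e| == 2%N].

Definition degree (n : nat) (E : {set {set 'I_n}}) (v : 'I_n) : nat :=
  #|[set e in E | v \in e]|.

Definition max_degree (n : nat) (E : {set {set 'I_n}}) : nat :=
  (\max_(v < n) degree E v)%N.

Definition proper_coloring (n c : nat) (E : {set {set 'I_n}})
    (f : {ffun 'I_n -> 'I_c}) : bool :=
  [forall u, forall v, ([set u; v]%SET \in E) ==> (f u != f v)].

Definition colorable (n c : nat) (E : {set {set 'I_n}}) : bool :=
  [exists f : {ffun 'I_n -> 'I_c}, proper_coloring E f].

Definition edge_stream (n : nat) (E : {set {set 'I_n}})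
    (es : seq {set 'I_n}) : bool :=
  perm_eq es (enum E).

(* The memory consists of s bits.  The algorithm may be non-uniform, and the
   extra nat argument (the number of edges read so far) is a clock that is not
   charged to the memory; it allows a randomized algorithm to use fresh coins
   at every step. *)
Record det_alg (n c s : nat) : Type := DetAlg {
  init : s.-tuple bool;
  step : nat -> s.-tuple bool -> {set 'I_n} -> s.-tuple bool;
  output : nat -> s.-tuple bool -> {ffun 'I_n -> 'I_c}
}.

Fixpoint process (n c s : nat) (A : det_alg n c s) (t : nat)
    (m : s.-tuple bool) (es : seq {set 'I_n}) : s.-tuple bool :=
  if es is e :: es' then process A t.+1 (step A t m e) es' else m.

Definition run (n c s : nat) (A : det_alg n c s) (es : seq {set 'I_n}) :
    {ffun 'I_n -> 'I_c} :=
  output A (size es) (process A 0 (init A) es).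

(* A random choice of a deterministic algorithm.  The sample space T carries
   all the coins, which are not charged to the memory; deterministic algorithms
   are the constant families. *)
Record rand_alg (d : measure_display) (T : measurableType d) (n c s : nat) :
    Type := RandAlg {
  alg : T -> det_alg n c s;
  run_measurable : forall (es : seq {set 'I_n}) (f : {ffun 'I_n -> 'I_c}),
    measurable [set w : T | run (alg w) es = f]%classic
}.

Definition colors_streams (R : realType) (d : measure_display)
    (T : measurableType d) (P : probability T R) (n c s : nat)
    (A : rand_alg T n c s) (Delta : nat) : Prop :=
  forall (E : {set {set 'I_n}}) (es : seq {set 'I_n}),
    simple_graph E -> max_degree E = Delta -> colorable c E ->
    edge_stream E es ->
    (((2 / 3 : R)%:E)
       <= P [set w : T | proper_coloring E (run (alg A w) es)]%classic)%E.

(* Main.v *)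
(* INDEX reduction.  Write k = Delta - c + 1 and L = (n - Delta + 2) / 3, and let
   t be the minimum of k and L.  Alice holds L * t bits x (i, d), and inserts for
   each of them the edge from A i to one of the two vertices B (i + d, 0) and
   B (i + d, 1) (index mod L), chosen by the bit.  To read the bit b = (i, d), Bob
   adds the edge between the two vertices B (i + d, _), a clique on c - 2 vertices K
   joined to A i and to these two vertices, and k - 1 further neighbours F of K,
   which bring the maximum degree to Delta.  The graph is c-colorable, and any
   c-coloring gives A i the color of the one of the two vertices B (i + d, _)
   that is not adjacent to it, so it reveals the bit.  A message of s bits that
   allows every bit to be recovered with probability 2/3 satisfies
   2 ^ N * 2 ^ (2 N / 3) <= sum_x 2 ^ (number of bits of x recovered)
                         <= 2 ^ s * 3 ^ N   with N = L * t, hence N <= 16 s. *)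

Require Import Defs.
From HB Require Import structures.
From mathcomp Require Import all_boot all_order all_algebra.
From mathcomp Require Import all_classical all_reals all_analysis.
From mathcomp Require Import measurable_realfun ring lra zify.

Set Implicit Arguments.
Unset Strict Implicit.
Unset Printing Implicit Defensive.

Import Order.TTheory GRing.Theory Num.Theory.

Local Open Scope ring_scope.

(** * Counting bound for INDEX, and fixing the coins *)

Lemma sum_expn2_agree (R : realType) (I : finType) (y : {ffun I -> bool}) :
  \sum_(x : {ffun I -> bool}) 2 ^+ (\sum_i (y i == x i))%N = 3 ^+ #|I| :> R.
Proof.
(* The sum factors over the coordinates, and each factor is 1 + 2 = 3. *)
under eq_bigr => x _ do rewrite -prodrXr.
rewrite -(bigA_distr_bigA (fun i b => 2 ^+ (y i == b) : R)).
rewrite (eq_bigr (fun=> 3)) ?prodr_const // => i _.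
by rewrite big_bool; case: (y i) => /=; rewrite expr0 expr1; lra.
Qed.

Lemma index_lower_bound (R : realType) (I : finType) (s : nat)
    (enc : {ffun I -> bool} -> s.-tuple bool) (dec : I -> s.-tuple bool -> bool) :
  (2 * (#|I| * 2 ^ #|I|) <= 3 * \sum_x \sum_i (dec i (enc x) == x i))%N ->
  (#|I| <= 16 * s)%N.
Proof.
set N := #|I| => hsum.
pose a x := (\sum_i (dec i (enc x) == x i))%N.
have up : \sum_x 2 ^+ a x <= 2 ^+ s * 3 ^+ N :> R.
  (* On a fixed message [m] the decoder makes one fixed guess, so the inputs encoded as [m]
     contribute at most [3 ^+ N]. *)
  rewrite (partition_big enc predT) //=.
  apply: (@le_trans _ _ (\sum_(m : s.-tuple bool) 3 ^+ N)).
    apply: ler_sum => m _; rewrite -(sum_expn2_agree R [ffun i => dec i m]).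
    rewrite big_mkcond; apply: ler_sum => x _; case: eqP => [<-|_].
      by rewrite le_eqVlt; apply/orP; left; apply/eqP; congr (_ ^+ _);
         apply: eq_bigr => i _; rewrite ffunE.
    exact: exprn_ge0.
  by rewrite sumr_const card_tuple card_bool -(mulr_natl _ (2 ^ s)) natrX.
(* Jensen's inequality, via the tangent line of the exponential at the mean 2N/3. *)
pose l : R := ln 2; pose e : R := expR (l * (2 / 3 * N%:R)).
have l0 : 0 <= l by rewrite ln_ge0 // ler1n.
have low : 2 ^+ N * e <= \sum_x 2 ^+ a x.
  apply: (@le_trans _ _ (\sum_x e * (1 + l * ((a x)%:R - 2 / 3 * N%:R)))).
    rewrite -mulr_sumr big_split /= sumr_const card_ffun card_bool -mulr_sumr sumrB.
    rewrite sumr_const card_ffun card_bool -natr_sum mulrC ler_wpM2l ?expR_ge0 //.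
    rewrite -natrX lerDl mulr_ge0 // subr_ge0 -mulr_natr.
    move: hsum; rewrite -(ler_nat R) !natrM -/N -/a; lra.
  apply: ler_sum => x _.
  apply: (@le_trans _ _ (e * expR (l * ((a x)%:R - 2 / 3 * N%:R)))).
    by rewrite ler_wpM2l ?expR_ge0 // expR_ge1Dx.
  rewrite -expRD -mulrDr addrC subrK mulrC expRM_natl lnK //.
  by rewrite posrE ltr0n.
(* [e] is 2 to the power 2N/3; cubing clears the fractional exponent. *)
have e3 : e ^+ 3 = 4 ^+ N.
  rewrite -expRM_natl.
  rewrite (_ : 3%:R * _ = (2 * N)%:R * l); last by rewrite natrM; field.
  by rewrite expRM_natl lnK ?posrE ?ltr0n // exprM -natrX.
have key : 32 ^+ N <= 8 ^+ s * 27 ^+ N :> R.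
  have : (2 ^+ N * e) ^+ 3 <= (2 ^+ s * 3 ^+ N) ^+ 3 :> R.
    by rewrite lerXn2r ?nnegrE ?mulr_ge0 ?expR_ge0 ?exprn_ge0 // (le_trans low).
  rewrite !exprMn e3 -!exprM ![(_ * 3)%N]mulnC !exprM -exprMn.
  by have [-> -> ->] : [/\ 2 ^+ 3 * 4 = 32 :> R, 2 ^+ 3 = 8 :> R & 3 ^+ 3 = 27 :> R]
    by split; ring.
(* N > 16 s is impossible because the 16th power of 32/27 exceeds 8. *)
rewrite leqNgt; apply/negP => ltN.
have : (32 / 27) ^+ N <= 8 ^+ s :> R.
  by rewrite expr_div_n ler_pdivrMr // exprn_gt0.
apply/negP; rewrite -ltNge.
apply: (@le_lt_trans _ _ ((32 / 27) ^+ (16 * s))); last first.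
  by rewrite ltr_eXn2l //; lra.
rewrite exprM lerXn2r ?nnegrE ?exprn_ge0 //; lra.
Qed.

(** First-moment argument: the expected number of events is at least two thirds of [#|J|], so some
    outcome reaches that number. *)
Lemma exists_many_events (R : realType) (d : measure_display)
    (T : measurableType d) (P : probability T R) (J : finType)
    (S : J -> T -> bool) :
  (0 < #|J|)%N ->
  (forall j, measurable [set w | S j w]%classic) ->
  (forall j, ((2 / 3 : R)%:E <= P [set w | S j w]%classic)%E) ->
  exists w, (2 * #|J| <= 3 * \sum_j S j w)%N.
Proof.
move=> J0 mS PS; apply: contrapT => /forallNP H.
(* If every outcome falls short, integrality leaves a gap of 1/3 below the mean, which keeps the
   inequality strict after integration. *)
have : (\int[P]_w (\sum_(j : J) (\1_[set w | S j w]%classic w)%:E)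
    <= \int[P]_w (cst ((2 * #|J|%:R - 1) / 3 : R)%:E w))%E.
  apply: ge0_le_integral => //.
  - by move=> w _; apply: sume_ge0 => j _; rewrite lee_fin indicE.
  - apply: emeasurable_sum => j; apply/measurable_EFinP.
    exact: measurable_indic.
  - move=> w _; rewrite sumEFin lee_fin.
    have /negP := H w; rewrite -ltnNge -(ltr_nat R) => Hw.
    have -> : \sum_(j : J) \1_[set w | S j w]%classic w
        = (\sum_j S j w)%N%:R :> R.
      rewrite natr_sum; apply: eq_bigr => j _; rewrite indicE.
      congr (_ %:R); congr nat_of_bool.
      by apply/idP/idP; rewrite inE.
    have {}Hw : ((3 * \sum_j S j w)%N + 1 <= 2 * #|J|)%N.
      by rewrite addn1 -(ltr_nat R).
    move: Hw; rewrite -(ler_nat R) natrD !natrM; lra.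
rewrite integral_cst // [X in (_ * X)%E](_ : _ = 1%E); last exact: probability_setT.
rewrite mule1 ge0_integral_sum //; last first.
- by move=> j; apply/measurable_EFinP; exact: measurable_indic.
apply/negP; rewrite -ltNge.
apply: (@lt_le_trans _ _ (\sum_(j : J) (2 / 3 : R)%:E)%E).
  rewrite sumEFin lte_fin sumr_const -mulr_natr; lra.
apply: lee_sum => j _; rewrite integral_indic // setIT; exact: PS.
Qed.

Local Close Scope ring_scope.
Local Open Scope nat_scope.

(** * Graphs given by symmetric relations *)

Section EdgeSet.
Variables (V : finType) (n : nat) (g : V -> 'I_n).

Definition edge_set (r : rel V) : {set {set 'I_n}} :=
  [set [set g p.1; g p.2] | p : V * V & r p.1 p.2].

Hypothesis g_inj : injective g.

Lemma set2_inj (T : finType) (x y z w : T) :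
  [set x; y] = [set z; w] -> (x = z /\ y = w) \/ (x = w /\ y = z).
Proof.
move=> /setP E.
move: (E x) (E y) (E z) (E w); rewrite !inE !eqxx !orbT /=.
by do ![case: eqP => [?|?] /=]; subst => //; auto.
Qed.

Lemma mem_edge_set (r : rel V) u v : symmetric r ->
  ([set g u; g v] \in edge_set r) = r u v.
Proof.
move=> rs; apply/imsetP/idP => [[[a b]]|ruv]; last by exists (u, v); rewrite ?inE.
rewrite inE /= => rab /set2_inj[] [/g_inj -> /g_inj ->] //.
by rewrite rs.
Qed.

Lemma edge_set_simple (r : rel V) : irreflexive r -> simple_graph (edge_set r).
Proof.
move=> ri; apply/forall_inP => e /imsetP[[a b]]; rewrite inE /= => rab ->.
by rewrite cards2 (inj_eq g_inj); case: (a =P b) rab => [->|//]; rewrite ?ri.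
Qed.

Lemma degree_edge_set (r : rel V) v : symmetric r -> irreflexive r ->
  degree (edge_set r) (g v) = \sum_w r v w.
Proof.
move=> rs ri; rewrite /degree.
rewrite (_ : finset _ = [set [set g v; g w] | w : V & r v w]).
  rewrite card_in_imset; first by rewrite -sum1dep_card big_mkcond; apply: eq_bigr => w _;
    case: (r v w).
  by move=> w w' _ _ /set2_inj[[_ /g_inj]|[/g_inj-> /g_inj]].
apply/setP => e; rewrite inE; apply/andP/imsetP => [[/imsetP[[a b]]]|[w]].
  rewrite inE /= => rab ->; rewrite !inE !(inj_eq g_inj) => /orP[] /eqP ->.
    by exists b; rewrite ?inE.
  by exists a; rewrite ?inE 1?rs // finset.setUC.
rewrite inE => rvw ->; split; first by rewrite mem_edge_set.
by rewrite !inE eqxx.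
Qed.

End EdgeSet.

(** * Elementary sums, splitting of runs, measurability *)

Lemma sum_eq1 (T : finType) (a : T) : \sum_x (x == a) = 1.
Proof. by rewrite (bigD1 a) //= eqxx big1 // => x /negbTE ->. Qed.

Lemma sum_neq (T : finType) (a : T) : \sum_x (a != x) = #|T|.-1.
Proof.
rewrite -(@cardC1 T a) -sum1_card [RHS]big_mkcond /=.
by apply: eq_bigr => x _; rewrite !inE eq_sym; case: eqP.
Qed.

Lemma sum_fst (T : finType) (a : T) : \sum_(p : T * bool) (p.1 == a) = 2.
Proof.
rewrite -(pair_bigA _ (fun x (_ : bool) => (x == a : nat))) /=.
under eq_bigr => x _ do rewrite big_const card_bool iter_addn_0 mulnC.
by rewrite -big_distrr /= sum_eq1.
Qed.

Lemma sum_leq_card (T : finType) (P : pred T) : \sum_x P x <= #|T|.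
Proof. by rewrite -sum1_card leq_sum // => x _; case: (P x). Qed.

Lemma sum_exists_leq (T : finType) (t : nat) (e : 'I_t -> pred T) :
  (forall d, \sum_x e d x <= 1) -> \sum_x [exists d, e d x] <= t.
Proof.
move=> h; apply: (@leq_trans (\sum_x \sum_d e d x)).
  apply: leq_sum => x _; case: existsP => //= -[d ed].
  by rewrite (bigD1 d) //= ed.
rewrite exchange_big /=; apply: (@leq_trans (\sum_(d < t) 1)); first exact: leq_sum.
by rewrite sum_nat_const muln1 card_ord.
Qed.

Lemma sum_ltn_ord (k r : nat) : k <= r -> \sum_(p < r) (p < k) = k.
Proof.
move=> kr; rewrite -(big_mkord xpredT (fun p => (p < k : nat))).
rewrite (@big_cat_nat _ _ _ k) //= [X in _ + X]big1_seq ?addn0.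
  rewrite -[RHS]subn0 -[RHS]muln1 -sum_nat_const_nat.
  by apply: eq_big_nat => p /andP[_ ->].
by move=> p /=; rewrite mem_index_iota => /andP[/leq_gtF ->].
Qed.

(** Cuts a run where Alice hands the memory to Bob; the clock goes on from the number of edges
    already read. *)
Lemma process_cat (n c s : nat) (M : det_alg n c s) (t : nat)
    (m : s.-tuple bool) (es es' : seq {set 'I_n}) :
  process M t m (es ++ es') = process M (t + size es) (process M t m es) es'.
Proof. by elim: es t m => [|e es IH] t m /=; rewrite ?addn0 // IH addSnnS. Qed.

Lemma measurable_run_pred (d : measure_display) (T : measurableType d)
    (n c s : nat) (M : rand_alg T n c s) (es : seq {set 'I_n})
    (Q : pred {ffun 'I_n -> 'I_c}) :
  measurable [set w | Q (run (alg M w) es)]%classic.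
Proof.
rewrite (_ : mkset _ =
    (\bigcup_(f in [set f | Q f]) [set w | run (alg M w) es = f])%classic).
  by apply: fin_bigcup_measurable => // f _; apply: run_measurable.
by apply/seteqP; split => [w Qw|w [f Qf /= ->] //]; exists (run (alg M w) es).
Qed.

(** * The hard instance: adjacency, degrees and coloring *)

(* Here [c = c'.+2], [Delta = c' + k' + 2] and [L = L'.+1].  The summands of [V] are
   the vertices A, B, K and F; only the first [k'] vertices of the last summand are
   joined to K, and the others pad the graph to the required number of vertices. *)
Section HardInstance.
Variables (L' c' k' t r : nat).
Local Notation L := L'.+1.
Local Notation V := (('I_L + 'I_L * bool) + ('I_c' + 'I_r))%type.
Local Notation A i := (inl (inl i) : V).
Local Notation B p := (inl (inr p) : V).
Local Notation K q := (inr (inl q) : V).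
Local Notation F p := (inr (inr p) : V).
Local Notation bits := ('I_L * 'I_t)%type.

Hypothesis tL : t <= L.
Hypothesis tk : t <= k'.+1.
Hypothesis kc : k' <= c'.
Hypothesis kr : k' <= r.

(** As t <= L, cyclic shifts give each [A i] distinct slots and let at most [t] of the [A i] use any
    given slot. *)
Definition slot (b : bits) : 'I_L := (b.1 + inZp b.2)%R.

Definition alice_rel (x : {ffun bits -> bool}) : rel V := fun u v =>
  match u, v with
  | inl (inl i), inl (inr p) | inl (inr p), inl (inl i) =>
      [exists d, p == (slot (i, d), x (i, d))]
  | _, _ => false
  end.

Definition bob_rel (b : bits) : rel V := fun u v =>
  match u, v with
  | inl (inr p), inl (inr p') => [&& p.1 == slot b, p'.1 == slot b & p != p']
  | inr (inl _), inl (inl i) | inl (inl i), inr (inl _) => i == b.1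
  | inr (inl _), inl (inr p) | inl (inr p), inr (inl _) => p.1 == slot b
  | inr (inl q), inr (inl q') => q != q'
  | inr (inl _), inr (inr p) | inr (inr p), inr (inl _) => p < k'
  | _, _ => false
  end.

Definition full_rel x b : rel V := fun u v => alice_rel x u v || bob_rel b u v.

Lemma alice_rel_sym x : symmetric (alice_rel x).
Proof. by move=> [[?|?]|[?|?]] [[?|?]|[?|?]]. Qed.

Lemma bob_rel_sym b : symmetric (bob_rel b).
Proof.
move=> [[?|?]|[?|?]] [[?|?]|[?|?]] //=; last by rewrite eq_sym.
by rewrite andbCA [X in ~~ X]eq_sym.
Qed.

Lemma full_rel_sym x b : symmetric (full_rel x b).
Proof. by move=> u v; rewrite /full_rel alice_rel_sym bob_rel_sym. Qed.

Lemma full_rel_irr x b : irreflexive (full_rel x b).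
Proof. by move=> [[?|?]|[?|?]]; rewrite /full_rel /= ?eqxx ?andbF. Qed.

Lemma inZp_inj : injective (fun d : 'I_t => inZp d : 'I_L).
Proof.
move=> d d' /(congr1 val) /=; rewrite !modn_small ?(leq_trans (ltn_ord _)) //.
exact: val_inj.
Qed.

Lemma slot_injr i : injective (fun d => slot (i, d)).
Proof. by move=> d d' /addrI /inZp_inj. Qed.

Lemma sum_vertices (f : V -> nat) : \sum_v f v =
  \sum_i f (A i) + \sum_p f (B p) + (\sum_q f (K q) + \sum_p f (F p)).
Proof. by rewrite !big_sumType. Qed.

Lemma degree_alice_A x i : \sum_p alice_rel x (A i) (B p) <= t.
Proof. by apply: sum_exists_leq => d; rewrite sum_eq1. Qed.

Lemma degree_alice_B x p : \sum_i alice_rel x (B p) (A i) <= t.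
Proof.
apply: sum_exists_leq => d.
rewrite -(sum_eq1 (p.1 - inZp d)%R) leq_sum // => i _.
by case: eqP => // ->; rewrite /slot /= addrK eqxx.
Qed.

(** Degrees are at most t + c' on A, t + 1 + c' on B, c' + k' + 2 on K and c' on F, while t <= k' +
    1. *)
Lemma sum_full_rel_leq x b u : \sum_w full_rel x b u w <= c' + k' + 2.
Proof.
rewrite sum_vertices; case: u => [[i|p]|[q|p]]; rewrite /full_rel.
- rewrite [X in X + _ + _]big1 // [X in _ + (_ + X)]big1 //.
  under eq_bigr => p _ do rewrite orbF.
  move: (degree_alice_A x i) (sum_leq_card (fun q => bob_rel b (A i) (K q))).
  rewrite card_ord /=; lia.
- rewrite [X in _ + (_ + X)]big1 //.
  under eq_bigr => i _ do rewrite orbF.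
  (* Inside B a vertex can only be joined to its twin in the same slot. *)
  have : \sum_p' (alice_rel x (B p) (B p') || bob_rel b (B p) (B p')) <= 1.
    rewrite /= -(sum_eq1 (p.1, ~~ p.2)) leq_sum // => -[j y] _ /=.
    case: p => j' y' /=; case: eqP => //= ->; case: eqP => //= ->.
    by rewrite !xpair_eqE eqxx /=; case: y; case: y'.
  move: (degree_alice_B x p) (sum_leq_card (fun q => bob_rel b (B p) (K q))).
  rewrite card_ord /=; lia.
- rewrite /= sum_eq1 sum_fst sum_neq card_ord.
  rewrite (sum_ltn_ord kr); have := ltn_ord q; lia.
- rewrite [X in X + _ + _]big1 // [X in _ + X + _]big1 // [X in _ + (_ + X)]big1 //.
  move: (sum_leq_card (fun q => bob_rel b (F p) (K q))).
  rewrite card_ord /=; lia.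
Qed.

(** Any K vertex attains the bound. If K is empty, [kc] gives k' = 0, and the neighbours [A b.1] and
    the twin of [B (slot b, x b)] suffice. *)
Lemma sum_full_rel_geq x b : exists u, c' + k' + 2 <= \sum_w full_rel x b u w.
Proof.
have [c0|c0] := posnP c'; last first.
  exists (K (Ordinal c0)); rewrite sum_vertices /full_rel /=.
  by rewrite sum_eq1 sum_fst sum_neq card_ord (sum_ltn_ord kr); lia.
exists (B (slot b, x b)); rewrite sum_vertices.
have : 0 < \sum_i full_rel x b (B (slot b, x b)) (A i).
  rewrite (bigD1 b.1) //= /full_rel /=.
  by case: existsP => // -[]; exists b.2; rewrite -surjective_pairing.
have : 0 < \sum_p full_rel x b (B (slot b, x b)) (B p).
  rewrite (bigD1 (slot b, ~~ x b)) //= /full_rel /= !eqxx /= xpair_eqE.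
  by case: (x b); rewrite andbF.
lia.
Qed.

(* For [c' = 0] the color 2 does not exist, but then [t = 1] and the edges between A
   and B form a matching, so 0 is available for every A vertex. *)
Definition vertex_color (x : {ffun bits -> bool}) (b : bits) (v : V) : nat :=
  match v with
  | inl (inl i) => if i == b.1 then 0 else if c' == 0 then 0 else 2
  | inl (inr p) => ~~ ((p.1 == slot b) && (p.2 != x b))
  | inr (inl q) => q.+2
  | inr (inr _) => 0
  end.

Lemma vertex_color_ltn x b v : vertex_color x b v < c'.+2.
Proof.
case: v => [[i|p]|[q|p]] //=.
- by case: ifP => // _; case: (c') => [|[]].
- exact: (leq_ltn_trans (leq_b1 _)).
- by rewrite !ltnS.
Qed.

(** The only B vertex of color 0 is [B (slot b, ~~ x b)], which is not adjacent to [A b.1]. *)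
Lemma vertex_color_alice x b i p : alice_rel x (A i) (B p) ->
  vertex_color x b (A i) != vertex_color x b (B p).
Proof.
case: b => i0 d0; case/existsP => d /eqP-> /=.
have [->|ii0] := eqVneq i i0.
  by case: (_ =P slot _) => //= /slot_injr ->; rewrite !eqxx.
case: ifP => [/eqP c0|_]; last by case: (_ && _).
case: (_ =P slot _) => //=; rewrite /slot /=.
(* Here c' = 0, so [kc] and [tk] leave a single value for [d], and equal slots would force
   [i = i0]. *)
suff -> : d = d0 by move=> /addIr /eqP; rewrite (negbTE ii0).
by apply: val_inj; move: (ltn_ord d) (ltn_ord d0) => /=; lia.
Qed.

Lemma vertex_color_bob x b u v : bob_rel b u v ->
  vertex_color x b u != vertex_color x b v.
Proof.
case: u v => [[i|p]|[q|p]] [[i'|p']|[q'|p']] //=.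
- by move=> /eqP->; rewrite eqxx.
- case: p p' => [j y] [j' y'] /and3P[/= /eqP-> /eqP->].
  by rewrite !xpair_eqE !eqxx /=; case: y; case: y'; case: (x b).
- by case: (_ && _).
- by move=> /eqP->; rewrite eqxx.
- by case: (_ && _).
Qed.

Lemma vertex_color_proper x b u v : full_rel x b u v ->
  vertex_color x b u != vertex_color x b v.
Proof.
case/orP => [|/vertex_color_bob //]; case: u v => [[i|p]|//] [[i'|p']|//] //.
  exact: vertex_color_alice.
by rewrite alice_rel_sym eq_sym; apply: vertex_color_alice.
Qed.

(** * Hard graphs as streams, and decoding *)

Section Embedding.
Variables (n : nat) (g : V -> 'I_n) (h : 'I_n -> V).
Hypotheses (gK : cancel g h) (hK : cancel h g).

Let g_inj : injective g := can_inj gK.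

Definition hard_graph x b := edge_set g (full_rel x b).

Lemma mem_hard_graph x b u v :
  ([set g u; g v] \in hard_graph x b) = full_rel x b u v.
Proof. exact/mem_edge_set/full_rel_sym. Qed.

Lemma hard_graph_max_degree x b : max_degree (hard_graph x b) = c' + k' + 2.
Proof.
have degE u : degree (hard_graph x b) (g u) = \sum_w full_rel x b u w.
  exact: (degree_edge_set g_inj _ (full_rel_sym x b) (full_rel_irr x b)).
apply/eqP; rewrite eqn_leq; apply/andP; split.
  by apply/bigmax_leqP => v _; rewrite -(hK v) degE sum_full_rel_leq.
have [u /leq_trans->//] := sum_full_rel_geq x b.
by rewrite -degE leq_bigmax.
Qed.

Lemma hard_graph_colorable x b : colorable c'.+2 (hard_graph x b).
Proof.
apply/existsP; exists [ffun y => inord (vertex_color x b (h y))].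
apply/forallP => y; apply/forallP => z; apply/implyP.
rewrite -{1}(hK y) -{1}(hK z) mem_hard_graph => /vertex_color_proper.
apply: contra; rewrite !ffunE => /eqP/(congr1 (@nat_of_ord _)).
by rewrite !inordK ?vertex_color_ltn // => ->.
Qed.

Definition alice_edge (x : {ffun bits -> bool}) b : {set 'I_n} :=
  [set g (A b.1); g (B (slot b, x b))].

Definition alice_stream x := [seq alice_edge x b | b <- enum {: bits}].

Definition bob_stream b := enum (edge_set g (bob_rel b)).

Lemma size_alice_stream x : size (alice_stream x) = #|{: bits}|.
Proof. by rewrite size_map -cardE. Qed.

Lemma alice_edge_inj x : injective (alice_edge x).
Proof.
move=> [i d] [i' d'] /set2_inj[[/g_inj[->] /g_inj e]|[/g_inj//]].
congr (_, _); apply: (@slot_injr i').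
exact: (congr1 (fun v : V => if v is inl (inr p) then p.1 else i') e).
Qed.

(** Alice's edges all join A to B and Bob's never do, so no edge is listed twice. *)
Lemma hard_graph_stream x b :
  edge_stream (hard_graph x b) (alice_stream x ++ bob_stream b).
Proof.
apply: uniq_perm; rewrite ?enum_uniq // ?cat_uniq.
  rewrite (map_inj_uniq (@alice_edge_inj x)) !enum_uniq andbT /=.
  apply/hasPn => e; rewrite mem_enum; apply: contraL => /mapP[b' _ ->].
  by rewrite mem_edge_set //; apply: bob_rel_sym.
move=> e; rewrite mem_cat !mem_enum; apply/orP/imsetP => [[]|].
- case/mapP => b' _ ->; exists (A b'.1, B (slot b', x b')) => //.
  rewrite inE /full_rel /=; apply/orP; left; apply/existsP; exists b'.2.
  by rewrite -surjective_pairing.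
- case/imsetP => -[u v]; rewrite inE /= => uv ->.
  by exists (u, v) => //; rewrite inE /full_rel /= uv orbT.
case=> -[u v]; rewrite inE => /orP[] /= uv ->; last first.
  by right; rewrite mem_edge_set //; apply: bob_rel_sym.
left; apply/mapP; move: uv.
have AB i p : alice_rel x (A i) (B p) -> exists2 b', b' \in enum {: bits} &
    [set g (A i); g (B p)] = alice_edge x b'.
  by case/existsP => d' /eqP->; exists (i, d'); rewrite ?mem_enum.
case: u v => [[i|p]|//] [[i'|p']|//] //; first exact: AB.
by rewrite alice_rel_sym finset.setUC; apply: AB.
Qed.

Definition decode (b : bits) (f : {ffun 'I_n -> 'I_c'.+2}) : bool :=
  f (g (A b.1)) != f (g (B (slot b, true))).

(* If [x b = false], then [A b.1] and [B (slot b, true)] are both joined to the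
   clique formed by [B (slot b, false)] and the [K q], which leaves them a single
   color. *)
Lemma decode_proper x b f : proper_coloring (hard_graph x b) f ->
  decode b f = x b.
Proof.
move=> /forallP fp.
have {}fp u v : full_rel x b u v -> f (g u) != f (g v).
  rewrite -mem_hard_graph => uv.
  by move/forallP: (fp (g u)) => /(_ (g v)) /implyP; apply.
have fA : f (g (A b.1)) != f (g (B (slot b, x b))).
  apply: fp; rewrite /full_rel /=; apply/orP; left; apply/existsP; exists b.2.
  by rewrite -surjective_pairing.
rewrite /decode; case xb: (x b) fA => // fA.
apply: contraTF isT => fAB.
(* Pigeonhole: the nested options index c' + 3 vertices, which would all get distinct colors among
   c' + 2. *)
pose w (z : option (option (option 'I_c'))) : V :=
  match z with
  | None => A b.1
  | Some None => B (slot b, true)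
  | Some (Some None) => B (slot b, false)
  | Some (Some (Some q)) => K q
  end.
have winj : injective (fun z => f (g (w z))).
  move=> z z'; apply: contra_eq => zz'.
  have : [|| full_rel x b (w z) (w z'),
    (w z == A b.1) && (w z' == B (slot b, true)) |
    (w z' == A b.1) && (w z == B (slot b, true))].
    have AB : alice_rel x (A b.1) (B (slot b, false)).
      by apply/existsP; exists b.2; rewrite -surjective_pairing xb.
    have BA := AB; rewrite alice_rel_sym in BA; move: zz'.
    case: z z' => [[[q|]|]|] [[[q'|]|]|] //= qq';
      rewrite /full_rel /bob_rel ?AB ?BA /= ?xpair_eqE ?eqxx ?andbF ?orbT //.
    by apply/orP; left; apply: contraNneq qq' => ->.
  case/or3P => [/fp //|/andP[/eqP-> /eqP->]//|/andP[/eqP-> /eqP->]].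
  by rewrite eq_sym.
by have := leq_card _ winj; rewrite !card_option !card_ord ltnn.
Qed.

Lemma hard_instance_bound (R : realType) (d : measure_display)
    (T : measurableType d) (P : probability T R) (s : nat)
    (M : rand_alg T n c'.+2 s) :
  0 < t -> colors_streams P M (c' + k' + 2) -> L * t <= 16 * s.
Proof.
move=> t0 PM.
have -> : L * t = #|{: bits}| by rewrite card_prod !card_ord.
pose es x b := alice_stream x ++ bob_stream b.
pose S (j : {ffun bits -> bool} * bits) w :=
  decode j.2 (run (alg M w) (es j.1 j.2)) == j.1 j.2.
have mS j : measurable [set w | S j w]%classic.
  exact: (measurable_run_pred M (es j.1 j.2) (fun f => decode j.2 f == j.1 j.2)).
have PS j : ((2 / 3 : R)%:E <= P [set w | S j w]%classic)%E.
  have simple := edge_set_simple g_inj (full_rel_irr j.1 j.2).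
  apply: le_trans (PM _ _ simple (hard_graph_max_degree _ _)
    (hard_graph_colorable _ _) (hard_graph_stream _ _)) _.
  apply: le_measure; rewrite ?inE.
  - exact: (measurable_run_pred M (es j.1 j.2)
      (proper_coloring (hard_graph j.1 j.2))).
  - exact: mS.
  - by move=> w /decode_proper dw; apply/eqP.
have J0 : 0 < #|{: {ffun bits -> bool} * bits}|.
  by rewrite card_prod card_ffun card_bool card_prod !card_ord !muln_gt0 expn_gt0 t0.
have [w] := exists_many_events J0 mS PS.
(* With the coins [w] fixed, the memory after Alice's edges is the message. Their number does not
   depend on [x], so Bob knows the clock. *)
pose m0 x := process (alg M w) 0 (init (alg M w)) (alice_stream x).
pose dec b m := decode b (output (alg M w) (#|{: bits}| + size (bob_stream b))
  (process (alg M w) #|{: bits}| m (bob_stream b))).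
rewrite card_prod card_ffun card_bool [_ ^ _ * _]mulnC => hw.
apply: (@index_lower_bound R _ s m0 dec); apply: leq_trans hw _.
rewrite pair_big leq_eqVlt; apply/orP; left; apply/eqP; congr (3 * _).
apply: eq_bigr => -[x b] _; rewrite /S /dec /m0 /run /=.
by rewrite process_cat size_cat size_alice_stream.
Qed.

End Embedding.
End HardInstance.

(** * Choice of parameters and the final constant *)

Lemma card_eq_bijection (V : finType) (n : nat) : #|V| = n ->
  exists g : V -> 'I_n, exists2 h : 'I_n -> V, cancel g h & cancel h g.
Proof.
move=> <-; exists (@enum_rank V).
by exists (@enum_val V V); [apply: enum_rankK | apply: enum_valK].
Qed.

Lemma index_size_bound (R : realType) (Delta c n s : nat) (d : measure_display)
    (T : measurableType d) (P : probability T R) (M : rand_alg T n c s) :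
  (Delta + 1 < 2 * c) -> c <= Delta -> Delta < n ->
  colors_streams P M Delta ->
  (n - Delta + 2) %/ 3 * minn (Delta - c).+1 ((n - Delta + 2) %/ 3) <= 16 * s.
Proof.
move=> Dc cD Dn PM; set L := (_ %/ 3).
have L0 : 0 < L by rewrite /L; lia.
have Ln : 3 * L <= n - Delta + 2 by rewrite /L; lia.
have [c' ec] : exists c', c = c'.+2 by exists (c - 2); lia.
have [L' eL] : exists L', L = L'.+1 by exists L.-1; lia.
move: L eL L0 Ln => L -> _ Ln; subst c.
(* F takes all remaining vertices; 3 L <= n - Delta + 2 is exactly what makes k' <= r. *)
pose k' := Delta - c'.+2; pose r := n - 3 * L'.+1 - c'.
have : #|{: ('I_L'.+1 + 'I_L'.+1 * bool) + ('I_c' + 'I_r)}| = n.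
  by rewrite !card_sum card_prod card_bool !card_ord /r; lia.
case/card_eq_bijection => g [h gK hK].
apply: (@hard_instance_bound L' c' k' _ r _ _ _ _ n g h gK hK R d T P s M).
- exact: geq_minr.
- exact: geq_minl.
- by rewrite /k'; lia.
- by rewrite /k' /r; lia.
- by rewrite leq_min.
by rewrite (_ : c' + k' + 2 = Delta) // /k'; lia.
Qed.

Local Close Scope nat_scope.
Local Open Scope ring_scope.

(* Omega is uniform in Delta and c: the constant C depends only on eps, which
   keeps n away from Delta; eps = 1 gives an absolute constant for all
   n >= 2 Delta *)
Theorem theorem1p2 (R : realType) (eps : R) (heps : 0 < eps) :
  exists2 C : R, 0 < C &
    forall (Delta c n : nat),
      (0 < Delta)%N -> (0 < c)%N ->
      (Delta%:R + 1) / 2 < c%:R :> R -> (c <= Delta)%N ->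
      (1 + eps) * Delta%:R <= n%:R ->
      forall (s : nat) (d : measure_display) (T : measurableType d)
        (P : probability T R) (A : rand_alg T n c s),
        colors_streams P A Delta ->
        C * (n%:R * (Delta%:R - c%:R + 1)) <= s%:R.
Proof.
(* [x] is the fraction of n that n - Delta is guaranteed to reach. *)
pose x := eps / (1 + eps).
have x0 : 0 < x by rewrite divr_gt0 // addr_gt0.
have x1 : x <= 1 by rewrite ler_pdivrMr ?addr_gt0 // mul1r lerDr.
(* 144 = 3 * 3 * 16: a factor 3 for each of L and t, and 16 from the INDEX bound. *)
exists (x ^+ 2 / 144); first by rewrite divr_gt0 ?exprn_gt0.
move=> D c n D0 c0 Dc cD epsn s d T P A PA.
have D0' : 0 < D%:R :> R by rewrite ltr0n.
have epsD : 0 < eps * D%:R by rewrite mulr_gt0.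
have Dn : (D < n)%N by rewrite -(ltr_nat R); lra.
have Dc' : (D + 1 < 2 * c)%N by rewrite -(ltr_nat R) natrD natrM; lra.
have xn : x * n%:R <= n%:R - D%:R.
  rewrite /x mulrAC ler_pdivrMr ?addr_gt0 //; lra.
have := index_size_bound Dc' cD Dn PA.
set L := (_ %/ 3)%N; set t := minn _ _ => /= bound.
have Ln : x * n%:R <= 3 * L%:R.
  apply: (le_trans xn); rewrite -natrB ?(ltnW Dn) // -natrM ler_nat /L; lia.
set k : R := D%:R - c%:R + 1.
have kE : k = (D - c).+1%:R by rewrite -addn1 natrD natrB.
have k0 : 0 <= k by rewrite kE.
have kn : k <= n%:R by rewrite kE ler_nat; lia.
(* If t = k, use x <= 1; if t = L, use k <= n and the bound on L. *)
have tk : x * k <= 3 * t%:R.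
  have h1 : x * k <= k by rewrite ler_piMl.
  have h2 : x * k <= x * n%:R by rewrite ler_pM2l.
  rewrite /t /minn; case: ifP => _; last lra.
  rewrite -kE; lra.
have : (x * n%:R) * (x * k) <= (3 * L%:R) * (3 * t%:R).
  by apply: ler_pM => //; rewrite mulr_ge0 // ltW.
move: bound; rewrite -(ler_nat R) !natrM => bound h.
have -> : x ^+ 2 / 144 * (n%:R * k) = (x * n%:R) * (x * k) / 144 by field.
rewrite ler_pdivrMr //; apply: (le_trans h).
have -> : (3 * L%:R) * (3 * t%:R) = 9 * (L%:R * t%:R) :> R by ring.
lra.
Qed.
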